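(* (Within minimal logic, using the principle $\exists\mathrm{WF}_{\mathbb{N}}$.) Let $\boldsymbol{A} := (A^1, A^0)$ be a complemented subset of $\mathbb{N}$, and let $a^1 \in A^1$ with $a^1 > 0$. The following are equivalent: (i) $\boldsymbol{A}$ has a least element. (ii) $\boldsymbol{A}$ is downset located.
   Context: Setting: Bishop-style constructive mathematics. $\mathbb{N}$ has its usual equality $=_{\mathbb{N}}$ and a primitive decidable inequality $\neq_{\mathbb{N}}$ (an apartness relation with $x =_{\mathbb{N}} y \vee x \neq_{\mathbb{N}} y$ for all $x,y$), the usual orders $<,\leq$, and $\bot_{\mathbb{N}} := (0 =_{\mathbb{N}} 1)$. Minimal logic here means intuitionistic logic without the ex falso scheme $\bot_{\mathbb{N}} \Rightarrow Q$ for arbitrary formulas $Q$. A formula $P(x)$ on $\mathbb{N}$ is extensional if $x =_{\mathbb{N}} y$ and $P(x)$ imply $P(y)$. All subsets of $\mathbb{N}$ are extensional, i.e. of the form $\{x \in \mathbb{N} \mid P(x)\}$ with $P(x)$ extensional. A complemented subset of $\mathbb{N}$ is a pair $\boldsymbol{A} = (A^1, A^0)$ of (extensional) subsets of $\mathbb{N}$ such that $x \neq_{\mathbb{N}} y$ for all $x \in A^1$ and $y \in A^0$. Its domain is $\mathrm{dom}(\boldsymbol{A}) := A^1 \cup A^0$ (which need not be all of $\mathbb{N}$). For $x \in \mathrm{dom}(\boldsymbol{A})$, the downset of $x$ in $\boldsymbol{A}$ is $D_{\boldsymbol{A}}(x) := \{y \in \mathrm{dom}(\boldsymbol{A}) \mid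 y < x\}$. $\boldsymbol{A}$ is downset located if for every $x^1 \in A^1$: either $D_{\boldsymbol{A}}(x^1) \subseteq A^0$, or $D_{\boldsymbol{A}}(x^1)$ overlaps $A^1$, i.e. there are $y \in D_{\boldsymbol{A}}(x^1)$ and $z \in A^1$ with $y =_{\mathbb{N}} z$. A natural number $\mu$ is a least element of $\boldsymbol{A}$ if $\mu \in A^1$ and for every $x \in \mathrm{dom}(\boldsymbol{A})$, $x < \mu$ implies $x \in A^0$. The principle $\exists\mathrm{WF}_{\mathbb{N}}$: for all extensional formulas $P(x), Q(x)$ on $\mathbb{N}$, $$\Big[\exists_{x \in \mathbb{N}} Q(x) \ \&\ \forall_{x \in \mathbb{N}}\Big(Q(x) \Rightarrow \big[P(x) \vee \exists_{y \in \mathbb{N}}(y < x \ \&\ Q(y))\big]\Big)\Big] \Rightarrow \exists_{x \in \mathbb{N}} P(x).$$ *)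

(* Defs.v *)
(* Natural deduction for minimal first-order logic over the natural numbers,
   with de Bruijn variables ranging over N.  Relation symbols come from an
   arbitrary type [Rs] and stand for arbitrary further formulas on N; free
   variables act as parameters.  There is no primitive falsum: [Bot] is the
   equation 0 = 1, and no rule or arithmetical axiom has ex falso built in. *)
From Stdlib Require Import List.
Import ListNotations.
Set Implicit Arguments.

Inductive term : Type :=
| Var (n : nat)
| Zero
| Succ (t : term).

Inductive form (Rs : Type) : Type :=
| Eq (t u : term)
| Neq (t u : term)
| Lt (t u : term)
| Le (t u : term)
| Rel (r : Rs) (ts : list term)
| And (p q : form Rs)
| Or (p q : form Rs)
| Imp (p q : form Rs)
| All (p : form Rs)
| Ex (p : form Rs).

Arguments Eq {Rs} t u.
Arguments Neq {Rs} t u.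
Arguments Lt {Rs} t u.
Arguments Le {Rs} t u.

Declare Scope form_scope.
Delimit Scope form_scope with form.
Bind Scope form_scope with form.
Notation "t ≐ u" := (Eq t u) (at level 70) : form_scope.
Notation "t ≠ u" := (Neq t u) (at level 70) : form_scope.
Notation "t < u" := (Lt t u) : form_scope.
Notation "t ≤ u" := (Le t u) (at level 70) : form_scope.
Notation "p ∧ q" := (And p q) (at level 80, right associativity) : form_scope.
Notation "p ∨ q" := (Or p q) (at level 85, right associativity) : form_scope.
Notation "p ⇒ q" := (Imp p q) (at level 90, right associativity) : form_scope.
Notation "p ⇔ q" := (And (Imp p q) (Imp q p)) (at level 95) : form_scope.
Local Open Scope form_scope.

Definition Bot {Rs : Type} : form Rs := Zero ≐ Succ Zero.

Fixpoint tsubst (s : nat -> term) (t : term) : term :=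
  match t with
  | Var n => s n
  | Zero => Zero
  | Succ u => Succ (tsubst s u)
  end.

Definition lift : term -> term := tsubst (fun n => Var (S n)).

Definition up (s : nat -> term) (n : nat) : term :=
  match n with
  | 0 => Var 0
  | S m => lift (s m)
  end.

Fixpoint fsubst {Rs : Type} (s : nat -> term) (p : form Rs) : form Rs :=
  match p with
  | Eq t u => tsubst s t ≐ tsubst s u
  | Neq t u => tsubst s t ≠ tsubst s u
  | Lt t u => tsubst s t < tsubst s u
  | Le t u => tsubst s t ≤ tsubst s u
  | Rel r ts => Rel r (map (tsubst s) ts)
  | And p q => fsubst s p ∧ fsubst s q
  | Or p q => fsubst s p ∨ fsubst s q
  | Imp p q => fsubst s p ⇒ fsubst s q
  | All p => All (fsubst (up s) p)
  | Ex p => Ex (fsubst (up s) p)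
  end.

Definition flift {Rs : Type} : form Rs -> form Rs :=
  fsubst (fun n => Var (S n)).

(* A formula P(x) on N is a [form] whose variable 0 is x and whose variables
   1, 2, ... are the ambient variables 0, 1, ...  [inst k P t] is P(t) as
   written under [k] binders that P does not mention; [t] already lives under
   those binders.  In particular [inst 0 p t] eliminates the outermost
   binder of [All p] or [Ex p]. *)
Definition inst {Rs : Type} (k : nat) (P : form Rs) (t : term) : form Rs :=
  fsubst (fun n => match n with 0 => t | S m => Var (k + m) end) P.

Reserved Notation "T ;; G ⊢ p" (at level 99, G at level 98, p at level 98).

(* The axioms [T] may contain free variables, which are then read
   universally; the hypotheses [G] are a finite context. *)
Inductive prv {Rs : Type} (T : form Rs -> Prop) :
    list (form Rs) -> form Rs -> Prop :=
| prv_ax G p : T p -> T ;; G ⊢ p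
| prv_hyp G p : In p G -> T ;; G ⊢ p
| prv_andI G p q : T ;; G ⊢ p -> T ;; G ⊢ q -> T ;; G ⊢ p ∧ q
| prv_andE1 G p q : T ;; G ⊢ p ∧ q -> T ;; G ⊢ p
| prv_andE2 G p q : T ;; G ⊢ p ∧ q -> T ;; G ⊢ q
| prv_orI1 G p q : T ;; G ⊢ p -> T ;; G ⊢ p ∨ q
| prv_orI2 G p q : T ;; G ⊢ q -> T ;; G ⊢ p ∨ q
| prv_orE G p q r :
    T ;; G ⊢ p ∨ q -> T ;; p :: G ⊢ r -> T ;; q :: G ⊢ r -> T ;; G ⊢ r
| prv_impI G p q : T ;; p :: G ⊢ q -> T ;; G ⊢ p ⇒ q
| prv_impE G p q : T ;; G ⊢ p ⇒ q -> T ;; G ⊢ p -> T ;; G ⊢ q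
| prv_allI G p : T ;; map flift G ⊢ p -> T ;; G ⊢ All p
| prv_allE G p t : T ;; G ⊢ All p -> T ;; G ⊢ inst 0 p t
| prv_exI G p t : T ;; G ⊢ inst 0 p t -> T ;; G ⊢ Ex p
| prv_exE G p r :
    T ;; G ⊢ Ex p -> T ;; p :: map flift G ⊢ flift r -> T ;; G ⊢ r
where "T ;; G ⊢ p" := (prv T G p).

Definition extensional {Rs : Type} (P : form Rs) : form Rs :=
  All (All (Var 1 ≐ Var 0 ⇒ inst 2 P (Var 1) ⇒ inst 2 P (Var 0))).

(* Some of these are redundant. Equality is not assumed to satisfy Leibniz'
   law for the symbols of [Rs]: extensionality is always an explicit
   hypothesis. *)
Inductive nat_ax {Rs : Type} : form Rs -> Prop :=
| eq_refl_ax t : nat_ax (t ≐ t)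
| eq_sym_ax t u : nat_ax (t ≐ u ⇒ u ≐ t)
| eq_trans_ax t u v : nat_ax (t ≐ u ⇒ u ≐ v ⇒ t ≐ v)
| succ_ext_ax t u : nat_ax (t ≐ u ⇒ Succ t ≐ Succ u)
| succ_inj_ax t u : nat_ax (Succ t ≐ Succ u ⇒ t ≐ u)
| succ_neq0_ax t : nat_ax (Succ t ≐ Zero ⇒ Bot)
| ind_ax P : nat_ax (extensional P ⇒ inst 0 P Zero ⇒
    All (inst 1 P (Var 0) ⇒ inst 1 P (Succ (Var 0))) ⇒
    All (inst 1 P (Var 0)))
| neq_ext_ax t t' u u' : nat_ax (t ≐ t' ⇒ u ≐ u' ⇒ t ≠ u ⇒ t' ≠ u')
| neq_eq_ax t u : nat_ax (t ≐ u ⇒ t ≠ u ⇒ Bot)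
| neq_sym_ax t u : nat_ax (t ≠ u ⇒ u ≠ t)
| neq_cotrans_ax t u v : nat_ax (t ≠ u ⇒ t ≠ v ∨ v ≠ u)
| neq_dec_ax t u : nat_ax (t ≐ u ∨ t ≠ u)
| lt_ext_ax t t' u u' : nat_ax (t ≐ t' ⇒ u ≐ u' ⇒ t < u ⇒ t' < u')
| lt_irrefl_ax t : nat_ax (t < t ⇒ Bot)
| lt_trans_ax t u v : nat_ax (t < u ⇒ u < v ⇒ t < v)
| lt_total_ax t u : nat_ax (t < u ∨ t ≐ u ∨ u < t)
| lt_zero_ax t : nat_ax (t < Zero ⇒ Bot)
| lt_succ_ax t u : nat_ax (t < Succ u ⇔ t ≤ u)
| le_ax t u : nat_ax (t ≤ u ⇔ t < u ∨ t ≐ u).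

Definition existsWF {Rs : Type} (P Q : form Rs) : form Rs :=
  extensional P ⇒ extensional Q ⇒
  (Ex (inst 1 Q (Var 0)) ∧
   All (inst 1 Q (Var 0) ⇒
        inst 1 P (Var 0) ∨ Ex (Var 0 < Var 1 ∧ inst 2 Q (Var 0)))) ⇒
  Ex (inst 1 P (Var 0)).

Inductive nat_existsWF_ax {Rs : Type} : form Rs -> Prop :=
| nat_ax_in p : nat_ax p -> nat_existsWF_ax p
| existsWF_in P Q : nat_existsWF_ax (existsWF P Q).

(* A pair of formulas (A^1, A^0) on N; as with [inst], the argument [k] of the
   definitions below is the number of binders they are used under. *)
Record cpair (Rs : Type) := CPair { set1 : form Rs; set0 : form Rs }.

Definition in1 {Rs : Type} (A : cpair Rs) (k : nat) (t : term) : form Rs :=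
  inst k (set1 A) t.

Definition in0 {Rs : Type} (A : cpair Rs) (k : nat) (t : term) : form Rs :=
  inst k (set0 A) t.

Definition complemented {Rs : Type} (A : cpair Rs) : form Rs :=
  extensional (set1 A) ∧ extensional (set0 A) ∧
  All (All (in1 A 2 (Var 1) ⇒ in0 A 2 (Var 0) ⇒ Var 1 ≠ Var 0)).

Definition dom {Rs : Type} (A : cpair Rs) (k : nat) (t : term) : form Rs :=
  in1 A k t ∨ in0 A k t.

(* y ∈ D_A(x) *)
Definition in_downset {Rs : Type} (A : cpair Rs) (k : nat) (x y : term) :
    form Rs :=
  dom A k y ∧ y < x.

(* For each x in A^1: D_A(x) ⊆ A^0, or there are y in D_A(x) and z in A^1
   with y = z. *)
Definition downset_located {Rs : Type} (A : cpair Rs) : form Rs :=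
  All (in1 A 1 (Var 0) ⇒
    All (in_downset A 2 (Var 1) (Var 0) ⇒ in0 A 2 (Var 0)) ∨
    Ex (Ex (in_downset A 3 (Var 2) (Var 1) ∧ in1 A 3 (Var 0) ∧
            Var 1 ≐ Var 0))).

Definition least {Rs : Type} (A : cpair Rs) (k : nat) (m : term) : form Rs :=
  in1 A k m ∧
  All (dom A (S k) (Var 0) ⇒ Var 0 < lift m ⇒ in0 A (S k) (Var 0)).

Definition has_least {Rs : Type} (A : cpair Rs) : form Rs :=
  Ex (least A 1 (Var 0)).

(* Main.v *)
Require Import Defs.
From Stdlib Require Import List.
Import ListNotations.

(** Let [m] be a least element and [x] any number.  By trichotomy either
    [m < x], and then [m] itself witnesses that the downset of [x] overlaps
    [A^1], or [x < m] or [x = m], and then every element of the downset of [x]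
    lies below [m], hence in [A^0].  The case [x < m] contradicts [x ∈ A^1],
    but refuting it would only yield [0 = 1]; concluding
    D_A(x) ⊆ A^0 by transitivity of the order instead keeps the
    argument inside minimal logic ([least_located_at]).

    Conversely, for [x ∈ A^1] locatedness says that either [x] is a least
    element, because D_A(x) ⊆ A^0 is minimality of [x] in curried
    form, or some element of [A^1] lies strictly below [x]
    ([located_at_step]).  This is the hypothesis of the existential
    well-foundedness principle for Q(x) := x ∈ A^1 and
    P(x) := x is a least element; the latter is extensional because [A^1] and
    the order are ([extensional_least]), and [a] witnesses the former.

    Entering a binder replaces every hypothesis by its lift, so the
    predicates are written below at an arbitrary binder depth [k]: a lifted or
    instantiated predicate is then again the same predicate at another depth,
    and such identities all reduce to the composition law [fsubst_comp]. *)

Local Open Scope form_scope.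

(** * Substitution *)

Lemma tsubst_comp s r q t :
  (forall n, tsubst s (r n) = q n) -> tsubst s (tsubst r t) = tsubst q t.
Proof. intros H; induction t; simpl; congruence. Qed.

Lemma tsubst_id s t : (forall n, s n = Var n) -> tsubst s t = t.
Proof. intros H; induction t; simpl; congruence. Qed.

Lemma tsubst_lift s r t :
  (forall n, s (S n) = lift (r n)) -> tsubst s (lift t) = lift (tsubst r t).
Proof.
  intros H. unfold lift at 2.
  rewrite (tsubst_comp _ r (fun n => lift (r n))) by reflexivity.
  now apply tsubst_comp.
Qed.

Lemma tsubst_lift_id s t :
  (forall n, s (S n) = Var n) -> tsubst s (lift t) = t.
Proof.
  intros H. unfold lift. rewrite (tsubst_comp _ _ (fun n => Var n)) by exact H.
  now apply tsubst_id.
Qed.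

Lemma tsubst_up_lift s t : tsubst (up s) (lift t) = lift (tsubst s t).
Proof. now apply tsubst_lift. Qed.

Lemma up_comp s r q :
  (forall n, tsubst s (r n) = q n) ->
  forall n, tsubst (up s) (up r n) = up q n.
Proof.
  intros H [|n]; simpl; [reflexivity|]. now rewrite tsubst_up_lift, H.
Qed.

(** The composite is given pointwise, so that equality of substitutions is
    never needed as an equality of functions. *)
Lemma fsubst_comp {Rs} (p : form Rs) : forall s r q,
  (forall n, tsubst s (r n) = q n) -> fsubst s (fsubst r p) = fsubst q p.
Proof.
  induction p; intros s r' q' H; simpl; f_equal; eauto using tsubst_comp, up_comp.
  rewrite map_map. apply map_ext. eauto using tsubst_comp.
Qed.

(** * Derived rules *)

Lemma prv_cut {Rs} (T : form Rs -> Prop) G p q :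
  T ;; G ⊢ p -> T ;; p :: G ⊢ q -> T ;; G ⊢ q.
Proof. eauto using prv. Qed.

(** The rules that create a substitution, with the substituted formula given
    up to a provable equation, so that it can be stated in the intended
    form. *)
Lemma prv_allE_eq {Rs} (T : form Rs -> Prop) G p t q :
  T ;; G ⊢ All p -> inst 0 p t = q -> T ;; G ⊢ q.
Proof. intros H <-. now apply prv_allE. Qed.

Lemma prv_exI_eq {Rs} (T : form Rs -> Prop) G p t q :
  T ;; G ⊢ q -> inst 0 p t = q -> T ;; G ⊢ Ex p.
Proof. intros H <-. now apply prv_exI in H. Qed.

Lemma prv_exE_eq {Rs} (T : form Rs -> Prop) G p r r' :
  T ;; G ⊢ Ex p -> T ;; p :: map flift G ⊢ r' -> flift r = r' -> T ;; G ⊢ r.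
Proof. intros H H' <-. eauto using prv. Qed.

Lemma prv_mp_ax {Rs} (T : form Rs -> Prop) G p q :
  (forall f, nat_ax f -> T f) ->
  nat_ax (p ⇒ q) -> T ;; G ⊢ p -> T ;; G ⊢ q.
Proof. eauto using prv. Qed.

Lemma prv_eq_sym {Rs} (T : form Rs -> Prop) G t u :
  (forall f, nat_ax f -> T f) -> T ;; G ⊢ t ≐ u -> T ;; G ⊢ u ≐ t.
Proof. intros HT. apply prv_mp_ax; auto using @nat_ax. Qed.

Lemma prv_lt_trans {Rs} (T : form Rs -> Prop) G t u v :
  (forall f, nat_ax f -> T f) ->
  T ;; G ⊢ t < u -> T ;; G ⊢ u < v -> T ;; G ⊢ t < v.
Proof.
  intros HT H. apply prv_impE. revert H.
  apply prv_mp_ax; auto using @nat_ax.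
Qed.

Lemma prv_lt_ext {Rs} (T : form Rs -> Prop) G t t' u u' :
  (forall f, nat_ax f -> T f) ->
  T ;; G ⊢ t ≐ t' -> T ;; G ⊢ u ≐ u' -> T ;; G ⊢ t < u -> T ;; G ⊢ t' < u'.
Proof.
  intros HT H1 H2. apply prv_impE. revert H2. apply prv_impE. revert H1.
  apply prv_mp_ax; auto using @nat_ax.
Qed.

Lemma prv_eq_refl {Rs} (T : form Rs -> Prop) G t :
  (forall f, nat_ax f -> T f) -> T ;; G ⊢ t ≐ t.
Proof. auto using prv_ax, @nat_ax. Qed.

(** * Complemented subsets under binders *)

Definition ext_at {Rs} (k : nat) (P : form Rs) : form Rs :=
  All (All (Var 1 ≐ Var 0 ⇒
            inst (S (S k)) P (Var 1) ⇒ inst (S (S k)) P (Var 0))).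

Definition downset_in0 {Rs} (A : cpair Rs) (k : nat) (x : term) : form Rs :=
  All (in_downset A (S k) (lift x) (Var 0) ⇒ in0 A (S k) (Var 0)).

Definition downset_meets1 {Rs} (A : cpair Rs) (k : nat) (x : term) : form Rs :=
  Ex (Ex (in_downset A (S (S k)) (lift (lift x)) (Var 1) ∧
          in1 A (S (S k)) (Var 0) ∧ Var 1 ≐ Var 0)).

Definition located_at {Rs} (A : cpair Rs) (k : nat) (x : term) : form Rs :=
  downset_in0 A k x ∨ downset_meets1 A k x.

Ltac term_eq :=
  simpl; repeat first
    [ rewrite tsubst_up_lift
    | rewrite tsubst_lift_id by reflexivity ];
  reflexivity.

(* Congruence is restricted to the connectives: two formulas [fsubst s P] and
   [fsubst r P] must not be compared through [s = r], which would ask for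
   functional extensionality, but through [fsubst_comp]. *)
Ltac subst_eq :=
  unfold located_at, downset_meets1, downset_in0, ext_at, extensional, flift,
    downset_located, has_least, least, in_downset, dom, in1, in0, inst;
  simpl;
  repeat match goal with
    | |- And _ _ = _ => f_equal
    | |- Or _ _ = _ => f_equal
    | |- Imp _ _ = _ => f_equal
    | |- All _ = _ => f_equal
    | |- Ex _ = _ => f_equal
    | |- Eq _ _ = _ => f_equal
    | |- Lt _ _ = _ => f_equal
    end;
  first [ reflexivity
        | apply fsubst_comp; intros [|n]; term_eq
        | symmetry; apply fsubst_comp; intros [|n]; term_eq
        | term_eq
        | symmetry; term_eq ].

Tactic Notation "hyp" integer(n) :=
  apply prv_hyp; simpl; do n right; left; subst_eq.

Lemma prv_ext_at {Rs} (T : form Rs -> Prop) G k P t u :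
  T ;; G ⊢ ext_at k P -> T ;; G ⊢ t ≐ u ->
  T ;; G ⊢ inst k P t -> T ;; G ⊢ inst k P u.
Proof.
  intros H Htu. apply prv_impE. revert Htu. apply prv_impE.
  eapply prv_allE_eq with (t := u).
  - eapply prv_allE_eq with (t := t) (q := All (lift t ≐ Var 0 ⇒
      inst (S k) P (lift t) ⇒ inst (S k) P (Var 0))).
    + exact H.
    + subst_eq.
  - subst_eq.
Qed.

Lemma prv_least_below {Rs} (T : form Rs -> Prop) G (A : cpair Rs) k m y :
  T ;; G ⊢ least A k m -> T ;; G ⊢ dom A k y -> T ;; G ⊢ y < m ->
  T ;; G ⊢ in0 A k y.
Proof.
  intros H Hy. apply prv_impE. revert Hy. apply prv_impE.
  eapply prv_allE_eq with (t := y).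
  - exact (prv_andE2 H).
  - subst_eq.
Qed.

(** * A least element makes the set downset located *)

Lemma least_located_at {Rs} (T : form Rs -> Prop) (A : cpair Rs) G k m x :
  (forall f, nat_ax f -> T f) ->
  T ;; least A k m :: G ⊢ located_at A k x.
Proof.
  intros HT.
  apply prv_orE with (p := x < m) (q := x ≐ m ∨ m < x);
    [apply prv_ax, HT, lt_total_ax| |].
  - apply prv_orI1, prv_allI, prv_impI.
    apply prv_least_below with (m := lift m).
    + hyp 2.
    + eapply prv_andE1. hyp 0.
    + apply prv_lt_trans with (u := lift x); [exact HT| |hyp 1].
      eapply prv_andE2. hyp 0.
  - apply prv_orE with (p := x ≐ m) (q := m < x); [hyp 0| |].
    + apply prv_orI1, prv_allI, prv_impI.
      apply prv_least_below with (m := lift m).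
      * hyp 3.
      * eapply prv_andE1. hyp 0.
      * apply prv_lt_ext with (t := Var 0) (u := lift x);
          [exact HT|now apply prv_eq_refl|hyp 1|].
        eapply prv_andE2. hyp 0.
    + assert (Hm : T ;; (m < x) :: (x ≐ m ∨ m < x) :: least A k m :: G
                     ⊢ in1 A k m) by (eapply prv_andE1; hyp 2).
      apply prv_orI2.
      apply prv_exI_eq with (t := m) (q := Ex (
        in_downset A (S k) (lift x) (lift m) ∧
        in1 A (S k) (Var 0) ∧ lift m ≐ Var 0)); [|subst_eq].
      apply prv_exI_eq with (t := m) (q :=
        in_downset A k x m ∧ in1 A k m ∧ m ≐ m); [|subst_eq].
      repeat apply prv_andI;
        [now apply prv_orI1|hyp 0|exact Hm|now apply prv_eq_refl].
Qed.

Lemma has_least_located {Rs} (T : form Rs -> Prop) (A : cpair Rs) G :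
  (forall f, nat_ax f -> T f) ->
  T ;; has_least A :: G ⊢ downset_located A.
Proof.
  intros HT.
  apply prv_exE_eq with (p := least A 1 (Var 0))
    (r' := All (in1 A 2 (Var 0) ⇒ located_at A 2 (Var 0))); [hyp 0| |subst_eq].
  apply prv_allI, prv_impI.
  apply prv_cut with (p := least A 2 (Var 1)); [hyp 1|].
  now apply least_located_at.
Qed.

(** * A downset located set has a least element *)

(** Identifies the formula to which the well-foundedness principle is applied,
    and its instances there, with leastness at the right depth. *)
Lemma inst_least {Rs} (A : cpair Rs) k t :
  inst k (least A 1 (Var 0)) t = least A k t.
Proof. subst_eq. Qed.

Lemma least_ext_at {Rs} (T : form Rs -> Prop) (A : cpair Rs) G k t u :
  (forall f, nat_ax f -> T f) ->
  T ;; least A k t :: (t ≐ u) :: ext_at k (set1 A) :: G ⊢ least A k u.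
Proof.
  intros HT. apply prv_andI.
  - apply prv_ext_at with (t := t); [hyp 2|hyp 1|eapply prv_andE1; hyp 0].
  - apply prv_allI. do 2 apply prv_impI.
    apply prv_least_below with (m := lift t); [hyp 2|hyp 1|].
    apply prv_lt_ext with (t := Var 0) (u := lift u);
      [exact HT|now apply prv_eq_refl| |hyp 0].
    apply prv_eq_sym; [exact HT|hyp 3].
Qed.

Lemma extensional_least {Rs} (T : form Rs -> Prop) (A : cpair Rs) G :
  (forall f, nat_ax f -> T f) ->
  T ;; extensional (set1 A) :: G ⊢ extensional (least A 1 (Var 0)).
Proof.
  intros HT. unfold extensional at 2. rewrite !inst_least.
  apply prv_allI. apply prv_cut with (p := ext_at 1 (set1 A)); [hyp 0|].
  apply prv_allI. do 2 apply prv_impI.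
  apply prv_cut with (p := ext_at 2 (set1 A)); [hyp 2|].
  apply prv_cut with (p := Var 1 ≐ Var 0); [hyp 2|].
  apply prv_cut with (p := least A 2 (Var 1)); [hyp 2|].
  now apply least_ext_at.
Qed.

(** One descent step: an element of [A^1] that is not yet least has an element
    of [A^1] strictly below it. *)
Lemma located_at_step {Rs} (T : form Rs -> Prop) (A : cpair Rs) G k x :
  (forall f, nat_ax f -> T f) ->
  T ;; located_at A k x :: in1 A k x :: ext_at k (set1 A) :: G
    ⊢ least A k x ∨ Ex (Var 0 < lift x ∧ in1 A (S k) (Var 0)).
Proof.
  intros HT.
  apply prv_orE with (p := downset_in0 A k x) (q := downset_meets1 A k x);
    [hyp 0| |].
  - apply prv_orI1, prv_andI; [hyp 2|].
    apply prv_allI. do 2 apply prv_impI.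
    apply prv_impE with (p := in_downset A (S k) (lift x) (Var 0)).
    + eapply prv_allE_eq with (p := in_downset A (S (S k)) (lift (lift x)) (Var 0)
                                ⇒ in0 A (S (S k)) (Var 0)) (t := Var 0).
      * hyp 2.
      * subst_eq.
    + apply prv_andI; [hyp 1|hyp 0].
  - apply prv_orI2.
    eapply prv_exE_eq with
      (r' := Ex (Var 0 < lift (lift x) ∧ in1 A (S (S k)) (Var 0)));
      [hyp 0| |subst_eq].
    eapply prv_exE_eq with
      (r' := Ex (Var 0 < lift (lift (lift x)) ∧ in1 A (S (S (S k))) (Var 0)));
      [hyp 0| |subst_eq].
    (* [Var 1] and [Var 0] are the two equal witnesses y and z of the overlap;
       z is known to be in A^1, and y to be below x. *)
    apply prv_exI_eq with (t := Var 0) (q :=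
      Var 0 < lift (lift x) ∧ in1 A (S (S k)) (Var 0)); [|subst_eq].
    apply prv_cut with (p := in_downset A (S (S k)) (lift (lift x)) (Var 1) ∧
      in1 A (S (S k)) (Var 0) ∧ Var 1 ≐ Var 0); [hyp 0|].
    apply prv_andI.
    + apply prv_lt_ext with (t := Var 1) (u := lift (lift x));
        [exact HT| |now apply prv_eq_refl|].
      * do 2 eapply prv_andE2. hyp 0.
      * eapply prv_andE2, prv_andE1. hyp 0.
    + eapply prv_andE1, prv_andE2. hyp 0.
Qed.

Lemma located_has_least {Rs} (A : cpair Rs) G a :
  nat_existsWF_ax ;; downset_located A :: extensional (set1 A) :: in1 A 0 a :: G
    ⊢ has_least A.
Proof.
  assert (HT : forall f : form Rs, nat_ax f -> nat_existsWF_ax f)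
    by apply nat_ax_in.
  eapply prv_impE; [eapply prv_impE; [eapply prv_impE|]|].
  - apply prv_ax.
    pose proof (existsWF_in (least A 1 (Var 0)) (set1 A)) as H.
    unfold existsWF in H. rewrite !inst_least in H. exact H.
  - apply prv_cut with (p := extensional (set1 A)); [hyp 1|].
    now apply extensional_least.
  - hyp 1.
  - apply prv_andI.
    + apply prv_exI_eq with (t := a) (q := in1 A 0 a); [hyp 2|subst_eq].
    + apply prv_allI, prv_impI.
      apply prv_cut with (p := ext_at 1 (set1 A)); [hyp 2|].
      apply prv_cut with (p := in1 A 1 (Var 0)); [hyp 1|].
      apply prv_cut with (p := located_at A 1 (Var 0));
        [|now apply located_at_step].
      apply prv_impE with (p := in1 A 1 (Var 0)); [|hyp 0].
      eapply prv_allE_eq with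
        (p := in1 A 2 (Var 0) ⇒ located_at A 2 (Var 0)) (t := Var 0);
        [hyp 3|subst_eq].
Qed.

Theorem theorem5p6 :
  forall (Rs : Type) (A : cpair Rs) (a : term),
    nat_existsWF_ax ;;
      [ complemented A; in1 A 0 a; (Zero < a)%form ]
      ⊢ (has_least A ⇔ downset_located A).
Proof.
  intros Rs A a. apply prv_andI; apply prv_impI.
  - apply has_least_located, nat_ax_in.
  - apply prv_cut with (p := in1 A 0 a); [hyp 2|].
    apply prv_cut with (p := extensional (set1 A)).
    + eapply prv_andE1. hyp 2.
    + apply prv_cut with (p := downset_located A); [hyp 2|].
      apply located_has_least.
Qed.
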